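(* Let $\mathbf{F}(t)$ be the fundamental endomorphism of a fanning frame $\mathcal{A}(t)$ of $2n\times n$ matrices. At each value of $t$ the derivative $\dot{\mathbf{F}}(t)$ is a reflection (i.e. $(\dot{\mathbf{F}}(t))^2=\mathbf{I}$) whose $-1$ eigenspace is spanned by the columns of $\mathcal{A}(t)$.
   Context: A fanning frame is a smooth curve $\mathcal{A}(t)$, $t\in\mathbb{R}$, of real $2n\times n$ matrices such that the $2n\times 2n$ matrix $(\mathcal{A}(t)|\dot{\mathcal{A}}(t))$ obtained by juxtaposition is invertible for all $t$. Its fundamental endomorphism at time $t$ is the linear transformation $\mathbf{F}(t)$ of $\mathbb{R}^{2n}$ (a $2n\times 2n$ matrix) defined by $\mathbf{F}(t)\mathcal{A}(t)=O$ and $\mathbf{F}(t)\dot{\mathcal{A}}(t)=\mathcal{A}(t)$. *)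

(* Defs.v *)
From mathcomp Require Import all_boot all_order all_algebra.
From mathcomp Require Import all_classical all_reals all_analysis.
Import numFieldNormedType.Exports.

Set Implicit Arguments.
Unset Strict Implicit.
Unset Printing Implicit Defensive.

Local Open Scope ring_scope.

(* [derive1n] is a total operator, so each derivative must also be shown to
   exist; direction [1] is the positive unit direction of the line. *)
Definition smooth_curve (R : realType) (V : normedModType R) (f : R -> V) :=
  forall (k : nat) (t : R), derivable (derive1n k f) t 1.

Definition fanning_frame (R : realType) (n : nat)
    (A : R -> 'M[R]_(n + n, n)) :=
  smooth_curve A /\ forall t : R, row_mx (A t) (derive1 A t) \in unitmx.

(* The columns of [A t] and [derive1 A t] form a basis of the space of column
   vectors, so these two equations determine [F t] uniquely. *)
Definition fundamental_endomorphism (R : realType) (n : nat)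
    (A : R -> 'M[R]_(n + n, n)) (F : R -> 'M[R]_(n + n)) :=
  forall t : R, F t *m A t = 0 /\ F t *m derive1 A t = A t.

(* [eigenspace] is the row space of left eigenvectors, whereas endomorphisms
   act here on column vectors; transposing [g] and [B] converts one convention
   into the other. *)
Definition eigenspace_spanned_by_cols (R : realType) (m p : nat)
    (g : 'M[R]_m) (a : R) (B : 'M[R]_(m, p)) :=
  (eigenspace g^T a :=: B^T)%MS.

(* Main.v *)
(** Differentiating F A = 0 and F A' = A gives F' A = -A and
    F' A' = A' - F A''.  The image of F lies in the span of the columns of A,
    so F' F = -F, and F'^2 = I follows by evaluating on the basis (A | A').
    Evaluating on the same basis gives F F' = F, so a (-1)-eigenvector v of F'
    satisfies F v = - F v, hence lies in the kernel of F, which is the span of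
    the columns of A. *)
Require Import Defs.
From mathcomp Require Import all_boot all_order all_algebra.
From mathcomp Require Import all_classical all_reals all_analysis.
Import GRing.Theory Num.Theory.
Import numFieldNormedType.Exports.

Local Open Scope ring_scope.

Lemma derivable_big_sum (R : numFieldType) (V W : normedModType R) (I : Type)
    (r : seq I) (P : pred I) (h : I -> V -> W) (x v : V) :
  (forall i, derivable (h i) x v) ->
  derivable (fun y => \sum_(i <- r | P i) h i y) x v.
Proof.
move=> dh; rewrite -fct_sumE.
by elim/big_ind: _ => [|f g|i _]; [exact: derivable_cst|exact: derivableD|].
Qed.

Lemma derivable_big_prod (R : numFieldType) (V : normedModType R) (I : Type)
    (r : seq I) (P : pred I) (h : I -> V -> R) (x v : V) :
  (forall i, derivable (h i) x v) ->
  derivable (fun y => \prod_(i <- r | P i) h i y) x v.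
Proof.
move=> dh; elim: r => [|i r IHr].
  by under eq_fun do rewrite big_nil; exact: derivable_cst.
under eq_fun do rewrite big_cons.
by case: (P i) => //; exact: derivableM.
Qed.

(** The Leibniz expansion is a finite sum of signed products of entries. *)
Lemma derivable_det (R : realFieldType) (V : normedModType R) (n : nat)
    (M : V -> 'M[R]_n) (x v : V) :
  derivable M x v -> derivable (fun y => \det (M y)) x v.
Proof.
move/derivable_mxP => dM; apply: derivable_big_sum => s.
apply: derivableM; first exact: derivable_cst.
by apply: derivable_big_prod => i; exact: dM.
Qed.

Lemma derivable_adjugate {R : realFieldType} {V : normedModType R} {n : nat}
    {M : V -> 'M[R]_n} {x v : V} :
  derivable M x v -> derivable (fun y => \adj (M y)) x v.
Proof.
move/derivable_mxP => dM; apply/derivable_mxP => i j.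
under eq_fun do rewrite mxE /cofactor.
apply: derivableM; first exact: derivable_cst.
apply: derivable_det; apply/derivable_mxP => k l.
by under eq_fun do rewrite !mxE; exact: dM.
Qed.

(** Cramer's formula: each entry is a cofactor divided by the determinant. Since [invmx] is defined
    by cases, invertibility at every [y] makes this formula an identity of functions. *)
Lemma derivable_invmx (R : realFieldType) (V : normedModType R) (n : nat)
    (M : V -> 'M[R]_n) (x v : V) :
  (forall y, M y \in unitmx) -> derivable M x v ->
  derivable (fun y => invmx (M y)) x v.
Proof.
move=> uM dM; apply/derivable_mxP => i j.
under eq_fun do rewrite /invmx uM mxE.
apply: derivableM; last first.
  by have /derivable_mxP := derivable_adjugate dM; exact.
apply: derivableV; last exact: derivable_det.
by rewrite -unitfE -unitmxE.
Qed.

Lemma is_derive_mulmx {R : realFieldType} {V : normedModType R} {m n p : nat}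
    {M : V -> 'M[R]_(m, n)} {N : V -> 'M[R]_(n, p)} {x v : V} :
  derivable M x v -> derivable N x v ->
  is_derive x v (fun y => M y *m N y) ('D_v M x *m N x + M x *m 'D_v N x).
Proof.
move=> dM dN.
have /derivable_mxP dMij := dM; have /derivable_mxP dNij := dN.
have dMN i j : is_derive x v (fun y => (M y *m N y) i j)
    (('D_v M x *m N x + M x *m 'D_v N x) i j).
  (* Written as a sum of products of scalar functions, the entry falls under the scalar Leibniz
     rule. *)
  have -> : (fun y => (M y *m N y) i j) =
      \sum_(k < n) ((fun y => M y i k) * (fun y => N y k j)).
    by apply/funext => y; rewrite mxE fct_sumE.
  apply: is_derive_eq.
    by apply: is_derive_sum => k; apply: is_deriveM; exact: derivableP.
  rewrite !mxE -big_split /=; apply: eq_bigr => k _.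
  by rewrite (derive_mx dM) (derive_mx dN) !mxE addrC; congr (_ + _); rewrite mulrC.
have dMNx : derivable (fun y => M y *m N y) x v.
  by apply/derivable_mxP => i j; exact: ex_derive.
apply: DeriveDef => //; rewrite (derive_mx dMNx).
by apply/matrixP => i j; rewrite mxE; exact: derive_val.
Qed.

Section Frame.
Context {R : realType} {n : nat}.
Implicit Types (A B : 'M[R]_(n + n, n)) (F D : 'M[R]_(n + n)).

(** The columns of [A] and [B] form a basis, and a linear map is determined by its values on a
    basis. *)
Lemma row_mx_unit_inj {p : nat} {A B} {X Y : 'M[R]_(p, n + n)} :
  row_mx A B \in unitmx -> X *m A = Y *m A -> X *m B = Y *m B -> X = Y.
Proof.
move=> uM eA eB; rewrite -(mulmxK uM X) -(mulmxK uM Y).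
by rewrite !mul_mx_row eA eB.
Qed.

(** From F (A|B) = (0|A), only the lower half of the inverse of (A|B) survives. The left factor [A]
    exhibits the image of [F] inside the column span of [A]. *)
Lemma endomorphism_factor {A B F} : row_mx A B \in unitmx ->
  F *m A = 0 -> F *m B = A -> F = A *m dsubmx (invmx (row_mx A B)).
Proof.
move=> uM FA FB; rewrite -[LHS](mulmxK uM) mul_mx_row FA FB.
by rewrite -[X in _ *m X]vsubmxK mul_row_col mul0mx add0r.
Qed.

(** Here [B], [C], [D] stand for A', A'', F' at a fixed time; the last two hypotheses are the
    differentiated relations, and only linear algebra remains. *)
Lemma derivative_involutive {A B C F D} : row_mx A B \in unitmx ->
  F *m A = 0 -> F *m B = A -> D *m A = - A -> D *m B + F *m C = B ->
  D *m D = 1%:M.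
Proof.
move=> uM FA FB DA /(canRL (addrK _)) DB.
have DF : D *m F = - F.
  by rewrite (endomorphism_factor uM FA FB) mulmxA DA mulNmx.
apply: (row_mx_unit_inj uM); rewrite mul1mx -mulmxA.
  by rewrite DA mulmxN DA opprK.
by rewrite DB mulmxBr DB mulmxA DF mulNmx opprK subrK.
Qed.

Lemma derivative_eigenspace {A B C F D} : row_mx A B \in unitmx ->
  F *m A = 0 -> F *m B = A -> D *m A = - A -> D *m B + F *m C = B ->
  eigenspace_spanned_by_cols D (-1) A.
Proof.
move=> uM FA FB DA /(canRL (addrK _)) DB.
have Ffac := endomorphism_factor uM FA FB.
have FD : F *m D = F.
  apply: (row_mx_unit_inj uM); rewrite -mulmxA.
    by rewrite DA mulmxN FA oppr0.
  by rewrite DB mulmxBr mulmxA [X in _ - F *m X *m _]Ffac mulmxA FA !mul0mx subr0.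
apply/eqmxP/andP; split; last first.
  by apply/eigenspaceP; rewrite -trmx_mul DA linearN scaleN1r.
set K := eigenspace _ _.
have DK : D *m K^T = - K^T.
  have /eigenspaceP/(congr1 trmx) : (K <= eigenspace D^T (-1))%MS by [].
  by rewrite trmx_mul trmxK scaleN1r linearN.
have FK : F *m K^T = 0.
  (* F K^T = F D K^T = - F K^T, and 2 is invertible. *)
  have : 2%:R *: (F *m K^T) = 0.
    by rewrite scaler_nat mulr2n -{2}FD -mulmxA DK mulmxN subrr.
  by move/eqP; rewrite scaler_eq0 pnatr_eq0 => /eqP.
(* [G] reads off the coordinates along [B]. As A G K^T = F K^T = 0, padding G K^T with a zero block
   and inverting (A|B) shows that these coordinates vanish on K^T. *)
set G := dsubmx (invmx (row_mx A B)) in Ffac.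
have GK : G *m K^T = 0.
  have : row_mx A B *m col_mx (G *m K^T) 0 = 0 :> 'M[R]_(_, _).
    by rewrite mul_row_col mulmx0 addr0 mulmxA -Ffac.
  move/(congr1 (mulmx (invmx (row_mx A B)))); rewrite mulKmx // mulmx0.
  by rewrite -[RHS]col_mx0 => /eq_col_mx[].
(* Expanding K^T in the basis (A|B) now leaves only a combination of the columns of [A]. *)
rewrite -[X in (X <= _)%MS]trmxK -[K^T](mulKVmx uM) -[X in _ *m (X *m _)]vsubmxK.
by rewrite mul_col_mx mul_row_col GK mulmx0 addr0 trmx_mul submxMl.
Qed.

End Frame.

Theorem proposition2p3 (R : realType) (n : nat)
    (A : R -> 'M[R]_(n + n, n)) (F : R -> 'M[R]_(n + n))
    (hA : fanning_frame A) (hF : fundamental_endomorphism A F) (t : R) :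
  [/\ derivable F t 1,
      derive1 F t *m derive1 F t = 1%:M
    & eigenspace_spanned_by_cols (derive1 F t) (-1) (A t)].
Proof.
have [sA uM] := hA; have [FA FB] := hF t.
have dA : derivable A t 1 := sA 0 t.
have dB : derivable (derive1 A) t 1 := sA 1 t.
have dF : derivable F t 1.
  (* Differentiability of [F] is inherited from A and A' through this closed formula. *)
  have -> : F = (fun s => row_mx 0 (A s) *m invmx (row_mx (A s) (derive1 A s))).
    apply/funext => s; have [FAs FBs] := hF s.
    by rewrite -[LHS](mulmxK (uM s)) mul_mx_row FAs FBs.
  apply: ex_derive; apply: is_derive_mulmx; last apply: derivable_invmx => //.
    apply/derivable_mxP => i j; under eq_fun do rewrite mxE.
    case: (fintype.split j) => k; last by move/derivable_mxP: dA; exact.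
    by under eq_fun do rewrite mxE; exact: derivable_cst.
  apply/derivable_mxP => i j; under eq_fun do rewrite mxE.
  by case: (fintype.split j) => k; [move/derivable_mxP: dA|move/derivable_mxP: dB]; exact.
have DA : derive1 F t *m A t = - A t.
  have /@derive_val := is_derive_mulmx dF dA.
  (* The product F A is identically zero, so its Leibniz derivative F' A + F A' vanishes. *)
  under eq_fun do rewrite (hF _).1.
  rewrite derive_cst -!derive1E FB => /esym/eqP.
  by rewrite addr_eq0 => /eqP.
have DB : derive1 F t *m derive1 A t + F t *m derive1 (derive1 A) t = derive1 A t.
  have /@derive_val := is_derive_mulmx dF dB.
  by under eq_fun do rewrite (hF _).2; rewrite -!derive1E => <-.
split=> //.
  exact: derivative_involutive (uM t) FA FB DA DB.
exact: derivative_eigenspace (uM t) FA FB DA DB.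
Qed.
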